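(* Let $\mathcal{X}$ and $\mathcal{C}$ be skew monoidal categories and let there be a weak action of $\mathcal{X}$ on $\mathcal{C}$. Then the associator $\alpha$ of the semidirect product $\mathcal{X} \ltimes \mathcal{C}$ satisfies the pentagon identity: for all objects $P, Q, R, S$ of $\mathcal{X} \ltimes \mathcal{C}$, \[ \alpha_{P \otimes Q, R, S} \circ \alpha_{P, Q, R \otimes S} = (\alpha_{P, Q, R} \otimes S) \circ \alpha_{P, Q \otimes R, S} \circ (P \otimes \alpha_{Q, R, S}) \] as morphisms $P \otimes (Q \otimes (R \otimes S)) \to ((P \otimes Q) \otimes R) \otimes S$.
   Context: An object's name also denotes its identity morphism. Skew monoidal category: a category with a functor $\otimes$ in two variables, an object $\mathcal{I}$, and natural transformations (not necessarily invertible) $\alpha_{A,B,C} \colon A \otimes (B \otimes C) \to (A \otimes B) \otimes C$, $\lambda_A \colon A \to \mathcal{I} \otimes A$, $\rho_A \colon A \otimes \mathcal{I} \to A$ satisfying: the pentagon identity $\alpha_{A \otimes B, C, D} \circ \alpha_{A, B, C \otimes D} = (\alpha_{A,B,C} \otimes D) \circ \alpha_{A, B \otimes C, D} \circ (A \otimes \alpha_{B,C,D})$; the three triangle identities $\alpha_{\mathcal{I},A,B} \circ \lambda_{A \otimes B} = \lambda_A \otimes B$, $(\rho_A \otimes B) \circ \alpha_{A,\mathcal{I},B} \circ (A \otimes \lambda_B) = \mathrm{id}_{A \otimes B}$, $\rho_{A \otimes B} \circ \alpha_{A,B,\mathcal{I}} = A \otimes \rho_B$; and the unitor identity $\rho_{\mathcal{I}}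 \circ \lambda_{\mathcal{I}} = \mathrm{id}_{\mathcal{I}}$. Weak action of $\mathcal{X}$ on $\mathcal{C}$: an oplax monoidal functor $\Gamma$ from $\mathcal{X}$ to the strict monoidal category of lax monoidal endofunctors of $\mathcal{C}$ and monoidal natural transformations, with tensor product given by composition in diagrammatic order. Explicitly: (1) for each object $X$ of $\mathcal{X}$, a functor $(-)^X \colon \mathcal{C} \to \mathcal{C}$ with a natural transformation $\varphi^X_{B,C} \colon B^X \otimes C^X \to (B \otimes C)^X$ and a morphism $\varphi^X \colon \mathcal{I}_{\mathcal{C}} \to \mathcal{I}_{\mathcal{C}}^X$ such that $(\alpha_{A,B,C})^X \circ \varphi^X_{A,B \otimes C} \circ (A^X \otimes \varphi^X_{B,C}) = \varphi^X_{A \otimes B, C} \circ (\varphi^X_{A,B} \otimes C^X) \circ \alpha_{A^X,B^X,C^X}$, $\varphi^X_{\mathcal{I}_{\mathcal{C}},C} \circ (\varphi^X \otimes C^X) \circ \lambda_{C^X} = (\lambda_C)^X$, and $(\rho_C)^X \circ \varphi^X_{C,\mathcal{I}_{\mathcal{C}}} \circ (C^X \otimes \varphi^X) = \rho_{C^X}$; (2) for each $f \colon X \to Y$ in $\mathcal{X}$, functorially in $f$, a natural transformation $(-)^f \colon (-)^X \to (-)^Y$ with $\varphi^Y_{B,C} \circ (B^f \otimes C^f) = (B \otimes C)^f \circ \varphi^X_{B,C}$ and $\mathcal{I}_{\mathcal{C}}^f \circ \varphi^X = \varphi^Y$; (3) morphisms $\psi^{X,Y}_C \colon C^{X \otimes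 Y} \to (C^X)^Y$, natural in $X, Y, C$, and $\psi_C \colon C^{\mathcal{I}_{\mathcal{X}}} \to C$, natural in $C$, such that $(\psi^{X,Y}_C)^Z \circ \psi^{X \otimes Y,Z}_C \circ C^{\alpha_{X,Y,Z}} = \psi^{Y,Z}_{C^X} \circ \psi^{X,Y \otimes Z}_C$, $(\psi_C)^X \circ \psi^{\mathcal{I}_{\mathcal{X}},X}_C \circ C^{\lambda_X} = \mathrm{id}_{C^X}$, and $\psi_{C^X} \circ \psi^{X,\mathcal{I}_{\mathcal{X}}}_C = C^{\rho_X}$; (4) these are monoidal natural transformations: $\psi^{X,Y}_{B \otimes C} \circ \varphi^{X \otimes Y}_{B,C} = (\varphi^X_{B,C})^Y \circ \varphi^Y_{B^X,C^X} \circ (\psi^{X,Y}_B \otimes \psi^{X,Y}_C)$, $\psi^{X,Y}_{\mathcal{I}_{\mathcal{C}}} \circ \varphi^{X \otimes Y} = (\varphi^X)^Y \circ \varphi^Y$, $\psi_{B \otimes C} \circ \varphi^{\mathcal{I}_{\mathcal{X}}}_{B,C} = \psi_B \otimes \psi_C$, and $\psi_{\mathcal{I}_{\mathcal{C}}} \circ \varphi^{\mathcal{I}_{\mathcal{X}}} = \mathrm{id}_{\mathcal{I}_{\mathcal{C}}}$. Semidirect product $\mathcal{X} \ltimes \mathcal{C}$: the underlying category is $\mathcal{X} \times \mathcal{C}$, with objects written $\langle X, C \rangle$. The tensor product is $\langle X, B \rangle \otimes \langle Y, C \rangle = \langle X \otimes Y, B^Y \otimes C \rangle$ (and correspondingly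 on morphisms) and the unit is $\langle \mathcal{I}_{\mathcal{X}}, \mathcal{I}_{\mathcal{C}} \rangle$. The structure maps are given by their components in $\mathcal{X}$ and in $\mathcal{C}$. Their $\mathcal{X}$-components are the structure maps $\alpha_{X,Y,Z}$, $\lambda_X$, $\rho_X$ of $\mathcal{X}$. Their $\mathcal{C}$-components are: for $\alpha_{\langle X,A \rangle, \langle Y,B \rangle, \langle Z,C \rangle}$, the composite $(\varphi^Z_{A^Y,B} \otimes C) \circ \alpha_{(A^Y)^Z,B^Z,C} \circ (\psi^{Y,Z}_A \otimes (B^Z \otimes C)) \colon A^{Y \otimes Z} \otimes (B^Z \otimes C) \to (A^Y \otimes B)^Z \otimes C$; for $\lambda_{\langle X,C \rangle}$, the composite $(\varphi^X \otimes C) \circ \lambda_C \colon C \to \mathcal{I}_{\mathcal{C}}^X \otimes C$; for $\rho_{\langle X,C \rangle}$, the composite $\rho_C \circ (\psi_C \otimes \mathcal{I}_{\mathcal{C}}) \colon C^{\mathcal{I}_{\mathcal{X}}} \otimes \mathcal{I}_{\mathcal{C}} \to C$. *)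

(* Defs.v *)
Set Implicit Arguments.
Unset Strict Implicit.
Unset Printing Implicit Defensive.

Declare Scope skew_scope.
Delimit Scope skew_scope with skew.
Local Open Scope skew_scope.

Record category : Type := Category {
  ob :> Type;
  hom : ob -> ob -> Type;
  idm : forall A : ob, hom A A;
  comp : forall A B C : ob, hom B C -> hom A B -> hom A C;
  comp_idl : forall (A B : ob) (f : hom A B), comp (idm B) f = f;
  comp_idr : forall (A B : ob) (f : hom A B), comp f (idm A) = f;
  comp_assoc : forall (A B C D : ob) (h : hom C D) (g : hom B C) (f : hom A B),
    comp h (comp g f) = comp (comp h g) f
}.

Arguments hom {c} A B.
Arguments idm {c} A.
Arguments comp {c A B C} g f.

Notation "g ∘ f" := (comp g f) (at level 40, left associativity) : skew_scope.

Record functor (C D : category) : Type := Functor {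
  fobj :> C -> D;
  fmap : forall A B : C, hom A B -> hom (fobj A) (fobj B);
  fmap_id : forall A : C, fmap (idm A) = idm (fobj A);
  fmap_comp : forall (A B E : C) (g : hom B E) (f : hom A B),
    fmap (g ∘ f) = fmap g ∘ fmap f
}.

Arguments fmap {C D} F {A B} f : rename.

Lemma prod_comp_idl (C D : category) (P Q : C * D)
  (f : hom (fst P) (fst Q) * hom (snd P) (snd Q)) :
  (idm (fst Q) ∘ fst f, idm (snd Q) ∘ snd f) = f.
Proof. destruct f; simpl; rewrite !comp_idl; reflexivity. Qed.

Lemma prod_comp_idr (C D : category) (P Q : C * D)
  (f : hom (fst P) (fst Q) * hom (snd P) (snd Q)) :
  (fst f ∘ idm (fst P), snd f ∘ idm (snd P)) = f.
Proof. destruct f; simpl; rewrite !comp_idr; reflexivity. Qed.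

Definition prod_cat (C D : category) : category := {|
  ob := C * D;
  hom := fun P Q => (hom (fst P) (fst Q) * hom (snd P) (snd Q))%type;
  idm := fun P => (idm (fst P), idm (snd P));
  comp := fun P Q R g f => (fst g ∘ fst f, snd g ∘ snd f);
  comp_idl := fun P Q f => prod_comp_idl f;
  comp_idr := fun P Q f => prod_comp_idr f;
  comp_assoc := fun P Q R S h g f =>
    f_equal2 pair (comp_assoc (fst h) (fst g) (fst f))
                  (comp_assoc (snd h) (snd g) (snd f))
|}.

(* The data of a skew monoidal category, before naturality of the structure
   maps and the coherence identities are required.  The two-variable functor is
   given in curried form. *)
Record skew_data : Type := SkewData {
  scat :> category;
  tens : scat -> scat -> scat;
  tens_hom : forall A A' B B' : scat,
    hom A A' -> hom B B' -> hom (tens A B) (tens A' B');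
  tens_hom_id : forall A B : scat,
    tens_hom (idm A) (idm B) = idm (tens A B);
  tens_hom_comp : forall (A A' A'' B B' B'' : scat)
      (f' : hom A' A'') (f : hom A A') (g' : hom B' B'') (g : hom B B'),
    tens_hom (f' ∘ f) (g' ∘ g) = tens_hom f' g' ∘ tens_hom f g;
  unit_ob : scat;
  assoc : forall A B C : scat, hom (tens A (tens B C)) (tens (tens A B) C);
  lunit : forall A : scat, hom A (tens unit_ob A);
  runit : forall A : scat, hom (tens A unit_ob) A
}.

Arguments tens {s} A B.
Arguments tens_hom {s A A' B B'} f g.
Arguments unit_ob {s}.
Arguments assoc {s} A B C.
Arguments lunit {s} A.
Arguments runit {s} A.

Notation "A ⊗ B" := (tens A B) (at level 35, right associativity)
  : skew_scope.
Notation "f ⊠ g" := (tens_hom f g) (at level 35, right associativity)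
  : skew_scope.

Record skew_monoidal : Type := SkewMonoidal {
  sdata :> skew_data;
  assoc_nat : forall (A A' B B' C C' : sdata)
      (f : hom A A') (g : hom B B') (h : hom C C'),
    assoc A' B' C' ∘ (f ⊠ (g ⊠ h)) = ((f ⊠ g) ⊠ h) ∘ assoc A B C;
  lunit_nat : forall (A B : sdata) (f : hom A B),
    lunit B ∘ f = (idm unit_ob ⊠ f) ∘ lunit A;
  runit_nat : forall (A B : sdata) (f : hom A B),
    runit B ∘ (f ⊠ idm unit_ob) = f ∘ runit A;
  skew_pentagon : forall A B C D : sdata,
    assoc (A ⊗ B) C D ∘ assoc A B (C ⊗ D)
    = (assoc A B C ⊠ idm D) ∘ assoc A (B ⊗ C) D ∘ (idm A ⊠ assoc B C D);
  skew_triangle_l : forall A B : sdata,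
    assoc unit_ob A B ∘ lunit (A ⊗ B) = lunit A ⊠ idm B;
  skew_triangle_m : forall A B : sdata,
    (runit A ⊠ idm B) ∘ assoc A unit_ob B ∘ (idm A ⊠ lunit B) = idm (A ⊗ B);
  skew_triangle_r : forall A B : sdata,
    runit (A ⊗ B) ∘ assoc A B unit_ob = idm A ⊠ runit B;
  skew_unitor : runit unit_ob ∘ lunit unit_ob = idm (unit_ob : sdata)
}.

(* Exponential notation: [act U A] is A^U, [fmap (act U) h] is h^U, and
   [actm f A] is A^f.  Objects of X are U, V, W; objects of C are A, B, D. *)
Record weak_action (X C : skew_monoidal) : Type := WeakAction {
  act : X -> functor C C;
  phi : forall (U : X) (A B : C), hom (act U A ⊗ act U B) (act U (A ⊗ B));
  phi0 : forall U : X, hom unit_ob (act U unit_ob);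
  phi_nat : forall (U : X) (A A' B B' : C) (f : hom A A') (g : hom B B'),
    phi U A' B' ∘ (fmap (act U) f ⊠ fmap (act U) g)
    = fmap (act U) (f ⊠ g) ∘ phi U A B;
  phi_assoc : forall (U : X) (A B D : C),
    fmap (act U) (assoc A B D) ∘ phi U A (B ⊗ D) ∘ (idm (act U A) ⊠ phi U B D)
    = phi U (A ⊗ B) D ∘ (phi U A B ⊠ idm (act U D))
      ∘ assoc (act U A) (act U B) (act U D);
  phi_lunit : forall (U : X) (A : C),
    phi U unit_ob A ∘ (phi0 U ⊠ idm (act U A)) ∘ lunit (act U A)
    = fmap (act U) (lunit A);
  phi_runit : forall (U : X) (A : C),
    fmap (act U) (runit A) ∘ phi U A unit_ob ∘ (idm (act U A) ⊠ phi0 U)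
    = runit (act U A);

  actm : forall (U V : X) (f : hom U V) (A : C), hom (act U A) (act V A);
  actm_nat : forall (U V : X) (f : hom U V) (A B : C) (h : hom A B),
    actm f B ∘ fmap (act U) h = fmap (act V) h ∘ actm f A;
  actm_id : forall (U : X) (A : C), actm (idm U) A = idm (act U A);
  actm_comp : forall (U V W : X) (g : hom V W) (f : hom U V) (A : C),
    actm (g ∘ f) A = actm g A ∘ actm f A;
  actm_phi : forall (U V : X) (f : hom U V) (A B : C),
    phi V A B ∘ (actm f A ⊠ actm f B) = actm f (A ⊗ B) ∘ phi U A B;
  actm_phi0 : forall (U V : X) (f : hom U V),
    actm f unit_ob ∘ phi0 U = phi0 V;

  psi : forall (U V : X) (A : C), hom (act (U ⊗ V) A) (act V (act U A));
  psi0 : forall A : C, hom (act unit_ob A) A;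
  psi_nat : forall (U V : X) (A B : C) (h : hom A B),
    psi U V B ∘ fmap (act (U ⊗ V)) h
    = fmap (act V) (fmap (act U) h) ∘ psi U V A;
  psi_nat_exp : forall (U U' V V' : X) (f : hom U U') (g : hom V V') (A : C),
    psi U' V' A ∘ actm (f ⊠ g) A
    = actm g (act U' A) ∘ fmap (act V) (actm f A) ∘ psi U V A;
  psi0_nat : forall (A B : C) (h : hom A B),
    psi0 B ∘ fmap (act unit_ob) h = h ∘ psi0 A;
  psi_assoc : forall (U V W : X) (A : C),
    fmap (act W) (psi U V A) ∘ psi (U ⊗ V) W A ∘ actm (assoc U V W) A
    = psi V W (act U A) ∘ psi U (V ⊗ W) A;
  psi_lunit : forall (U : X) (A : C),
    fmap (act U) (psi0 A) ∘ psi unit_ob U A ∘ actm (lunit U) A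
    = idm (act U A);
  psi_runit : forall (U : X) (A : C),
    psi0 (act U A) ∘ psi U unit_ob A = actm (runit U) A;

  psi_phi : forall (U V : X) (A B : C),
    psi U V (A ⊗ B) ∘ phi (U ⊗ V) A B
    = fmap (act V) (phi U A B) ∘ phi V (act U A) (act U B)
      ∘ (psi U V A ⊠ psi U V B);
  psi_phi0 : forall U V : X,
    psi U V unit_ob ∘ phi0 (U ⊗ V) = fmap (act V) (phi0 U) ∘ phi0 V;
  psi0_phi : forall A B : C,
    psi0 (A ⊗ B) ∘ phi unit_ob A B = psi0 A ⊠ psi0 B;
  psi0_phi0 : psi0 unit_ob ∘ phi0 unit_ob = idm (unit_ob : C)
}.

(* The morphism h^f : A^U -> B^V, for h : A -> B and f : U -> V. *)
Definition act_hom (X C : skew_monoidal) (W : weak_action X C) (U V : X)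
  (A B : C) (h : hom A B) (f : hom U V) : hom (act W U A) (act W V B) :=
  actm W f B ∘ fmap (act W U) h.

Lemma act_hom_id (X C : skew_monoidal) (W : weak_action X C) (U : X) (A : C) :
  act_hom W (idm A) (idm U) = idm (act W U A).
Proof. unfold act_hom; rewrite actm_id, fmap_id; apply comp_idl. Qed.

Lemma act_hom_comp (X C : skew_monoidal) (W : weak_action X C) (U V V' : X)
  (A B B' : C) (h' : hom B B') (h : hom A B) (f' : hom V V') (f : hom U V) :
  act_hom W (h' ∘ h) (f' ∘ f) = act_hom W h' f' ∘ act_hom W h f.
Proof.
unfold act_hom; rewrite actm_comp, fmap_comp.
rewrite !comp_assoc; f_equal.
rewrite <- !comp_assoc; f_equal.
apply actm_nat.
Qed.

Definition sd_tens (X C : skew_monoidal) (W : weak_action X C)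
    (P Q : prod_cat X C) : prod_cat X C :=
  (fst P ⊗ fst Q, act W (fst Q) (snd P) ⊗ snd Q).

Definition sd_tens_hom (X C : skew_monoidal) (W : weak_action X C)
    (P P' Q Q' : prod_cat X C) (f : hom P P') (g : hom Q Q') :
    hom (sd_tens W P Q) (sd_tens W P' Q') :=
  (fst f ⊠ fst g, act_hom W (snd f) (fst g) ⊠ snd g).

Lemma sd_tens_hom_id (X C : skew_monoidal) (W : weak_action X C)
  (P Q : prod_cat X C) :
  sd_tens_hom W (idm P) (idm Q) = idm (sd_tens W P Q).
Proof.
unfold sd_tens_hom; simpl; rewrite act_hom_id, !tens_hom_id; reflexivity.
Qed.

Lemma sd_tens_hom_comp (X C : skew_monoidal) (W : weak_action X C)
  (P P' P'' Q Q' Q'' : prod_cat X C)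
  (f' : hom P' P'') (f : hom P P') (g' : hom Q' Q'') (g : hom Q Q') :
  sd_tens_hom W (f' ∘ f) (g' ∘ g) = sd_tens_hom W f' g' ∘ sd_tens_hom W f g.
Proof.
unfold sd_tens_hom; simpl; rewrite act_hom_comp, !tens_hom_comp; reflexivity.
Qed.

Definition sd_assoc_snd (X C : skew_monoidal) (W : weak_action X C)
    (Y Z : X) (A B D : C) :
    hom (act W (Y ⊗ Z) A ⊗ (act W Z B ⊗ D)) (act W Z (act W Y A ⊗ B) ⊗ D) :=
  (phi W Z (act W Y A) B ⊠ idm D)
  ∘ assoc (act W Z (act W Y A)) (act W Z B) D
  ∘ (psi W Y Z A ⊠ idm (act W Z B ⊗ D)).

Definition sd_lunit_snd (X C : skew_monoidal) (W : weak_action X C)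
    (U : X) (A : C) : hom A (act W U unit_ob ⊗ A) :=
  (phi0 W U ⊠ idm A) ∘ lunit A.

Definition sd_runit_snd (X C : skew_monoidal) (W : weak_action X C) (A : C) :
    hom (act W unit_ob A ⊗ unit_ob) A :=
  runit A ∘ (psi0 W A ⊠ idm unit_ob).

Definition semidirect (X C : skew_monoidal) (W : weak_action X C) :
    skew_data := {|
  scat := prod_cat X C;
  tens := sd_tens W;
  tens_hom := @sd_tens_hom X C W;
  tens_hom_id := @sd_tens_hom_id X C W;
  tens_hom_comp := @sd_tens_hom_comp X C W;
  unit_ob := (unit_ob, unit_ob);
  assoc := fun P Q R =>
    (assoc (fst P) (fst Q) (fst R),
     sd_assoc_snd W (fst Q) (fst R) (snd P) (snd Q) (snd R));
  lunit := fun P => (lunit (fst P), sd_lunit_snd W (fst P) (snd P));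
  runit := fun P => (runit (fst P), sd_runit_snd W (snd P))
|}.

(* Main.v *)
(** For a fixed exponent [V], the maps
    [beta : A^V ⊗ (B^V ⊗ E) -> (A ⊗ B)^V ⊗ E] built from the associator and the
    lax structure of [(-)^V] satisfy a pentagon of their own, which follows from
    the pentagon in [C] and the associativity of [phi].  The [C]-component of
    the semidirect associator is [beta] precomposed with [psi].  Monoidality of
    [psi] turns the [beta] for [U ⊗ V] into the one for [V], and the coherence
    of [psi] with the associator of [X] matches the remaining factors. *)

Require Import Defs.
Local Open Scope skew_scope.

Lemma tens_hom_compl (M : skew_data) (A A' A'' B : M)
    (f' : hom A' A'') (f : hom A A') :
  (f' ∘ f) ⊠ idm B = (f' ⊠ idm B) ∘ (f ⊠ idm B).
Proof. rewrite <- tens_hom_comp, comp_idl; reflexivity. Qed.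

Lemma tens_hom_compr (M : skew_data) (A B B' B'' : M)
    (g' : hom B' B'') (g : hom B B') :
  idm A ⊠ (g' ∘ g) = (idm A ⊠ g') ∘ (idm A ⊠ g).
Proof. rewrite <- tens_hom_comp, comp_idl; reflexivity. Qed.

Section ActAssoc.

Context (X C : skew_monoidal) (W : weak_action X C).

(** This is the map [beta] above. [E] carries no exponent because the last factor of a product in
    the semidirect product is not acted upon. *)
Definition act_assoc (V : X) (A B E : C) :
    hom (act W V A ⊗ (act W V B ⊗ E)) (act W V (A ⊗ B) ⊗ E) :=
  (phi W V A B ⊠ idm E) ∘ assoc (act W V A) (act W V B) E.

Lemma act_assoc_nat (V : X) (A A' B B' E E' : C)
    (f : hom A A') (g : hom B B') (h : hom E E') :
  act_assoc V A' B' E' ∘ (fmap (act W V) f ⊠ (fmap (act W V) g ⊠ h))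
  = (fmap (act W V) (f ⊠ g) ⊠ h) ∘ act_assoc V A B E.
Proof.
unfold act_assoc.
rewrite <- comp_assoc, assoc_nat, !comp_assoc, <- !tens_hom_comp.
rewrite phi_nat, comp_idl, comp_idr; reflexivity.
Qed.

Lemma act_assoc_pentagon (V : X) (A B D E : C) :
  act_assoc V (A ⊗ B) D E ∘ act_assoc V A B (act W V D ⊗ E)
  = (fmap (act W V) (assoc A B D) ⊠ idm E) ∘ act_assoc V A (B ⊗ D) E
    ∘ (idm (act W V A) ⊠ act_assoc V B D E).
Proof.
(* In the middle term every [phi] stands to the left of both associators, so the pentagon of [C],
   and then [phi_assoc] tensored with [E], apply. *)
transitivity
  (((phi W V (A ⊗ B) D ∘ (phi W V A B ⊠ idm (act W V D))) ⊠ idm E)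
   ∘ (assoc (act W V A ⊗ act W V B) (act W V D) E
      ∘ assoc (act W V A) (act W V B) (act W V D ⊗ E))).
- unfold act_assoc; rewrite tens_hom_compl, <- !comp_assoc; f_equal.
  rewrite !comp_assoc, <- assoc_nat, tens_hom_id; reflexivity.
- rewrite skew_pentagon, !comp_assoc, <- tens_hom_compl, <- phi_assoc.
  rewrite !tens_hom_compl; unfold act_assoc.
  rewrite tens_hom_compr, !comp_assoc; f_equal.
  rewrite <- !comp_assoc; do 2 f_equal.
  symmetry; apply assoc_nat.
Qed.

(** Tensor [psi_phi] with [E]; naturality of the associator then carries both [psi] factors to its
    source. *)
Lemma act_assoc_psi (U V : X) (A B E : C) :
  (psi W U V (A ⊗ B) ⊠ idm E) ∘ act_assoc (U ⊗ V) A B E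
  = (fmap (act W V) (phi W U A B) ⊠ idm E)
    ∘ act_assoc V (act W U A) (act W U B) E
    ∘ (psi W U V A ⊠ (psi W U V B ⊠ idm E)).
Proof.
unfold act_assoc.
rewrite !comp_assoc, <- !tens_hom_compl, psi_phi, tens_hom_compl.
rewrite <- !comp_assoc, assoc_nat; reflexivity.
Qed.

Lemma sd_assoc_snd_pentagon (Y Z T : X) (A B D E : C) :
  sd_assoc_snd W Z T (act W Y A ⊗ B) D E
    ∘ sd_assoc_snd W Y (Z ⊗ T) A B (act W T D ⊗ E)
  = (act_hom W (sd_assoc_snd W Y Z A B D) (idm T) ⊠ idm E)
    ∘ sd_assoc_snd W (Y ⊗ Z) T A (act W Z B ⊗ D) E
    ∘ (act_hom W (idm A) (assoc Y Z T) ⊠ sd_assoc_snd W Z T B D E).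
Proof.
assert (sd_assocE : forall U V A' B' E',
    sd_assoc_snd W U V A' B' E'
    = act_assoc V (act W U A') B' E' ∘ (psi W U V A' ⊠ idm (act W V B' ⊗ E')))
  by reflexivity.
(* Common form of both sides: every [act_assoc] has exponent [T], and the two [psi] on [A] are
   adjacent, ready for [psi_assoc]. *)
transitivity
  ((fmap (act W T) ((phi W Z (act W Y A) B ⊠ idm D)
                    ∘ assoc (act W Z (act W Y A)) (act W Z B) D) ⊠ idm E)
   ∘ act_assoc T (act W Z (act W Y A)) (act W Z B ⊗ D) E
   ∘ ((psi W Z T (act W Y A) ∘ psi W Y (Z ⊗ T) A)
      ⊠ (act_assoc T (act W Z B) D E
         ∘ (psi W Z T B ⊠ idm (act W T D ⊗ E))))).
- rewrite !sd_assocE.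
  rewrite !comp_assoc.
  rewrite <- (comp_assoc (act_assoc T _ _ _)).
  rewrite act_assoc_psi, !comp_assoc.
  (* The identity is put in the form [fmap (act W T) (idm D) ⊠ idm E] that [act_assoc_nat]
     requires. *)
  rewrite <- (tens_hom_id (act W T D) E), <- (fmap_id (act W T) D).
  rewrite act_assoc_nat, fmap_id, tens_hom_id.
  rewrite <- (comp_assoc _ (act_assoc T _ _ _) (act_assoc T _ _ _)).
  rewrite act_assoc_pentagon, fmap_comp, tens_hom_compl, <- !comp_assoc.
  do 3 f_equal.
  rewrite <- !tens_hom_comp.
  rewrite comp_idr, comp_idl; reflexivity.
- unfold act_hom; rewrite actm_id, comp_idl, fmap_id, comp_idr.
  rewrite !sd_assocE; unfold act_assoc at 3.
  rewrite (fmap_comp (act W T) _ (psi W Y Z A ⊠ _)), tens_hom_compl.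
  rewrite <- !comp_assoc; f_equal.
  (* Here the associator of [X] enters. The new factor [fmap (act W T) (psi W Y Z A)] is matched by
     sliding its counterpart through [act_assoc] by naturality. *)
  rewrite <- psi_assoc.
  rewrite (comp_assoc (fmap (act W T) (psi W Y Z A ⊠ _) ⊠ idm E)).
  rewrite <- act_assoc_nat, <- !comp_assoc; f_equal.
  rewrite fmap_id, tens_hom_id, <- !tens_hom_comp, !comp_idl, comp_assoc.
  reflexivity.
Qed.

End ActAssoc.

Theorem lemma4p2 (X C : skew_monoidal) (W : weak_action X C)
    (P Q R S : semidirect W) :
  assoc (P ⊗ Q) R S ∘ assoc P Q (R ⊗ S)
  = (assoc P Q R ⊠ idm S) ∘ assoc P (Q ⊗ R) S ∘ (idm P ⊠ assoc Q R S).
Proof.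
(* Composition and tensor are pairs by definition, so the two components can be treated
   separately. *)
apply (f_equal2 pair).
- apply skew_pentagon.
- apply sd_assoc_snd_pentagon.
Qed.
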